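(* Distributional chaos in a sequence (SDC) and $\omega$-chaos do not imply each other. That is: (i) there exist a metric space $X$ and a continuous map $f\colon X\to X$ that is SDC but not $\omega$-chaotic; and (ii) there exist a metric space $Y$ and a continuous map $g\colon Y\to Y$ that is $\omega$-chaotic but not SDC.
   Context: Let $(X,d)$ be a metric space and $f\colon X\to X$ continuous; $f^n$ denotes the $n$-fold iterate of $f$ and $\#$ denotes cardinality. For a strictly increasing sequence $\{q_i\}_{i\ge0}$ of positive integers, $x,y\in X$ and $t>0$ put $$F(f,x,y,t,q_i)=\liminf_{n\to\infty}\frac1n\#\{i : d(f^{q_i}(x),f^{q_i}(y))<t,\ 0\le i<n\},$$ $$F^*(f,x,y,t,q_i)=\limsup_{n\to\infty}\frac1n\#\{i : d(f^{q_i}(x),f^{q_i}(y))<t,\ 0\le i<n\}.$$ The map $f$ is distributionally chaotic in a sequence (SDC) if, for some such sequence $\{q_i\}$, there exists an uncountable subset $S\subseteq X$ such that for every pair $x,y\in S$ of distinct points, $F(f,x,y,\varepsilon,q_i)=0$ for some $\varepsilon>0$ and $F^*(f,x,y,t,q_i)=1$ for all $t>0$. Let $\omega(x,f)$ denote the set of $\omega$-limit points of $x$ under $f$. A set $S\subseteq X$ is an $\omega$-scrambled set if for any $x,y\in S$ with $x\ne y$: (1) $\omega(x,f)\setminus\omega(y,f)$ is uncountable; (2) $\omega(x,f)\cap\omega(y,f)$ is nonempty; (3) $\omega(x,f)$ is not contained in the set of periodic points of $f$. The map $f$ is $\omega$-chaotic if there exists an uncountable $\omega$-scrambled set. *)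

(* Defs.v *)
From HB Require Import structures.
From mathcomp Require Import all_boot all_order all_algebra.
From mathcomp Require Import all_classical all_reals all_analysis.

Set Implicit Arguments.
Unset Strict Implicit.
Unset Printing Implicit Defensive.

Import Order.TTheory GRing.Theory Num.Theory.
Import numFieldNormedType.Exports.

Local Open Scope classical_set_scope.
Local Open Scope ring_scope.

(* The value at n = 0 is 0 / 0 = 0, which does not affect limits. *)
Definition prox_freq (R : realType) (X : metricType R) (f : X -> X)
    (x y : X) (t : R) (q : nat -> nat) (n : nat) : R :=
  #|[pred i : 'I_n | mdist (iter (q i) f x) (iter (q i) f y) < t]|%:R / n%:R.

Definition lower_dist (R : realType) (X : metricType R) (f : X -> X)
    (x y : X) (t : R) (q : nat -> nat) : R :=
  limn_inf (prox_freq f x y t q).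

Definition upper_dist (R : realType) (X : metricType R) (f : X -> X)
    (x y : X) (t : R) (q : nat -> nat) : R :=
  limn_sup (prox_freq f x y t q).

Definition SDC (R : realType) (X : metricType R) (f : X -> X) : Prop :=
  exists q : nat -> nat,
    [/\ increasing_seq q, (forall i, (0 < q i)%N) &
      exists S : set X, ~ countable S /\
        forall x y, S x -> S y -> x <> y ->
          (exists2 e : R, 0 < e & lower_dist f x y e q = 0) /\
          (forall t : R, 0 < t -> upper_dist f x y t q = 1)].

(* Cluster points of the orbit sequence n |-> f^n x, so the values of an
   eventually periodic orbit are included. *)
Definition omega_limit (R : realType) (X : metricType R) (f : X -> X)
    (x : X) : set X :=
  cluster (iter n f x @[n --> \oo]).

Definition periodic_points (T : Type) (f : T -> T) : set T :=
  [set x | exists2 n : nat, (0 < n)%N & iter n f x = x].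

Definition omega_scrambled (R : realType) (X : metricType R) (f : X -> X)
    (S : set X) : Prop :=
  forall x y, S x -> S y -> x <> y ->
    [/\ ~ countable (omega_limit f x `\` omega_limit f y),
        omega_limit f x `&` omega_limit f y !=set0 &
        ~ (omega_limit f x `<=` periodic_points f)].

Definition omega_chaotic (R : realType) (X : metricType R) (f : X -> X)
    : Prop :=
  exists S : set X, ~ countable S /\ omega_scrambled f S.

(* Main.v *)
Require Import Defs.
From HB Require Import structures.
From mathcomp Require Import all_boot all_order all_algebra.
From mathcomp Require Import all_classical all_reals all_analysis.
From mathcomp Require Import lra.

Set Implicit Arguments.
Unset Strict Implicit.
Unset Printing Implicit Defensive.

Import Order.TTheory GRing.Theory Num.Theory.
Import numFieldNormedType.Exports.

Local Open Scope classical_set_scope.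
Local Open Scope ring_scope.

(** Both examples live on non-compact spaces, which makes them elementary.
    They share one kind of metric, a base pseudo-distance to which heights are
    added: d(a, b) = [label a <> label b] + |pos a - pos b| + height a +
    height b for a <> b.  A point of positive height h is isolated, because
    every other point is at distance at least h; points of height 0 are the
    only possible accumulation points.  This allows uncountably many orbits to
    come close to the same points while being disjoint.

    SDC without omega-chaos ([climb]).  On R x nat the map is
    (x, n) |-> (x, n + 1), the label is the level n, and all points of level n
    have the same positive height.  Every point is isolated and no orbit
    returns to a level, so all omega-limit sets are empty and no pair is
    omega-scrambled.  Two distinct points of level 0 are, at time n, at
    distance twice the height of level n.  The heights are 1 or tend to 0,
    alternately on the blocks [B, B^2) with B = 2^(2^k) of levels n - 1.  At the end
    of a block only a proportion 1/B of the past times lies outside it, so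
    level 0 is an uncountable set as required in SDC ([climb_lower],
    [climb_upper]).

    omega-chaos without SDC ([visit]).  The limit points are the triples
    (c, x, k) with c either a real (a private fibre) or None (a common fibre),
    x real and k natural, all of height 0, moved isometrically by
    k |-> k + 1.  A wanderer s, a real number, spends its block m shadowing the
    limit orbit (c, x, 0), (c, x, 1), ..., (c, x, m) at height 1 / (m + 1),
    where (c, x) = [target s m], and then jumps to block m + 1.  The jumps
    leave every bounded range of k, so the map is continuous.  The targets
    are such that wanderer s approximates all points of its private fibre and
    infinitely often visits the common one; hence any two omega-limit sets
    share a point, and each contains an uncountable set missed by the other
    ([visit_omega_chaotic]).  The blocks in which s visits the common fibre
    form, for varying s, an almost disjoint family
    ([target_almost_disjoint]).  So two wanderers started in the same phase
    are eventually at distance at least 1, and two limit points keep their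
    distance.  Such pairs have upper distribution 0 at some t > 0 along every
    sequence ([upper_dist_apart]).  Since there are only countably many
    phases, every uncountable set contains such a pair ([visit_not_SDC]). *)

(** * Upper and lower limits, cardinality *)

Section limits.
Variables (R : realType) (u : R^nat).

Lemma limn_sup_eq1 : (forall n, u n <= 1) ->
  (forall e : R, 0 < e -> forall N, exists2 n, (N <= n)%N & 1 - e <= u n) ->
  limn_sup u = 1.
Proof.
move=> u_le1 near1; suff -> : limn_sup u = limn (fun _ : nat => (1 : R^o)).
  by rewrite lim_cst.
rewrite /limn_sup; congr (limn _); apply/funext => N.
have ub1 : ubound (sdrop u N) 1 by move=> _ [n _ <-].
apply/eqP; rewrite eq_le ge_sup//=; last by exists (u N), N => /=.
apply/ler_addgt0Pr => e e0; have [n Nn en] := near1 e e0 N.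
rewrite -lerBlDr (le_trans en)//; apply: ub_le_sup; first by exists 1.
by exists n.
Qed.

Lemma limn_inf_eq0 : (forall n, 0 <= u n) ->
  (forall e : R, 0 < e -> forall N, exists2 n, (N <= n)%N & u n <= e) ->
  limn_inf u = 0.
Proof.
move=> u_ge0 near0; suff -> : limn_inf u = limn (fun _ : nat => (0 : R^o)).
  by rewrite lim_cst.
rewrite /limn_inf; congr (limn _); apply/funext => N.
have lb0 : lbound (sdrop u N) 0 by move=> _ [n _ <-].
apply/eqP; rewrite eq_le; apply/andP; split; last first.
  by apply: lb_le_inf => //; exists (u N), N => /=.
apply/ler_addgt0Pr => e e0; have [n Nn en] := near0 e e0 N.
rewrite add0r (le_trans _ en)//; apply: ge_inf; first by exists 0.
by exists n.
Qed.

End limits.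

(** A countable set is a Lebesgue null set, and [0, 1] is not one. *)
Lemma uncountable_realType (R : realType) : ~ countable [set: R].
Proof.
move=> cR; have := @countable_lebesgue_measure0 R `[0, 1]%classic.
rewrite lebesgue_measure_itv/= lte_fin ltr01 oppr0 adde0 => /(_ _)/eqP.
rewrite eqe oner_eq0 => c; apply/notF/c.
exact/(sub_countable _ cR)/subset_card_le.
Qed.

Lemma countable_image_inj (T U : Type) (A : set T) (f : T -> U) :
  {in A &, injective f} -> countable (f @` A) -> countable A.
Proof.
move=> finj /countable_injP[g ginj]; apply/countable_injP; exists (g \o f).
move=> x y Ax Ay /= /ginj gxy; apply: finj => //; apply: gxy; apply/mem_set;
  [exists x | exists y] => //; exact/set_mem.
Qed.

Lemma uncountable_two (T : Type) (S : set T) :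
  ~ countable S -> exists x y, [/\ S x, S y & x <> y].
Proof.
move=> ncS; apply: contrapT => all_eq; apply: ncS; apply/countable_injP.
exists (fun=> 0%N) => x y /set_mem Sx /set_mem Sy _; apply: contrapT => xy.
by apply: all_eq; exists x, y.
Qed.

Lemma injective_nat_unbounded (u : nat -> nat) :
  injective u -> forall N, exists k, (N <= u k)%N.
Proof.
move=> uinj N; apply: contrapT => /forallNP uN.
have := @uniq_leq_size _ (map u (iota 0 N.+1)) (iota 0 N).
rewrite map_inj_uniq// iota_uniq size_map !size_iota ltnn => /(_ isT) H.
apply/notF/H => _ /mapP[k _ ->].
by rewrite mem_iota add0n /= ltnNge; apply/negP/uN.
Qed.

(** * Proximity frequencies *)

Section frequencies.
Variables (R : realType) (X : metricType R) (f : X -> X) (x y : X).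
Variables (t : R) (q : nat -> nat).
Local Notation close i := (mdist (iter (q i) f x) (iter (q i) f y) < t).

Lemma card_ord_lt (P : pred nat) (n N : nat) :
  (forall i, (i < n)%N -> P i -> (i < N)%N) ->
  (#|[pred i : 'I_n | P i]| <= N)%N.
Proof.
move=> PN; rewrite -[leqRHS](size_iota 0) cardE -(size_map val).
apply: uniq_leq_size.
  by rewrite map_inj_uniq ?enum_uniq//; exact: val_inj.
move=> _ /mapP[i + ->]; rewrite mem_enum inE mem_iota /= => Pi.
by rewrite add0n PN.
Qed.

Lemma prox_freq_ge0 n : 0 <= prox_freq f x y t q n.
Proof. by rewrite /prox_freq divr_ge0. Qed.

Lemma prox_freq_le1 n : prox_freq f x y t q n <= 1.
Proof.
rewrite /prox_freq; case: n => [|n]; first by rewrite invr0 mulr0.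
rewrite ler_pdivrMr ?mul1r ?ltr0n// ler_nat.
by rewrite (leq_trans (max_card _))// card_ord.
Qed.

Lemma prox_freq_le n N :
  (forall i, (i < n)%N -> close i -> (i < N)%N) ->
  prox_freq f x y t q n <= N%:R / n%:R.
Proof.
move=> cN; rewrite /prox_freq ler_wpM2r ?invr_ge0// ler_nat.
exact: (card_ord_lt cN).
Qed.

Lemma prox_freq_ge n N : (0 < n)%N ->
  (forall i, (i < n)%N -> ~~ (close i) -> (i < N)%N) ->
  1 - N%:R / n%:R <= prox_freq f x y t q n.
Proof.
move=> n0 cN; rewrite lerBlDr /prox_freq -mulrDl ler_pdivlMr ?ltr0n// mul1r.
rewrite -natrD ler_nat -{1}(card_ord n) -(cardC [pred i : 'I_n | close i]).
by rewrite leq_add2l; exact: (card_ord_lt cN).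
Qed.

(** At most N indices are close, because [q i >= i]; so the frequency is at most
    N / n and tends to 0. *)
Lemma upper_dist_apart N : increasing_seq q ->
  (forall n, (N <= n)%N -> t <= mdist (iter n f x) (iter n f y)) ->
  upper_dist f x y t q = 0.
Proof.
move=> incq apart.
have q_ge i : (i <= q i)%N.
  elim: i => // i /leq_ltn_trans; apply.
  by rewrite ltnNge; have := incq i.+1 i; rewrite leEnat ltnn => ->.
have freq0 : prox_freq f x y t q @ \oo --> (0 : R^o).
  apply: (@squeeze_cvgr _ _ _ _ (fun=> 0) (fun n => N%:R / n%:R)).
  - near=> n; rewrite prox_freq_ge0/= prox_freq_le// => i _ ci.
    rewrite ltnNge; apply/negP => Ni; move: ci.
    by rewrite ltNge apart// (leq_trans Ni).
  - exact: cvg_cst.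
  - rewrite -[X in _ --> X](mulr0 (N%:R : R)); apply: cvgMr.
    rewrite -(cvg_shiftS (fun n => n%:R^-1 : R)); exact: cvg_harmonic.
by rewrite /upper_dist (cvg_limn_inf_sup freq0).2.
Unshelve. all: by end_near. Qed.

End frequencies.

(** * Continuity and omega-limit points in terms of the distance *)

Section metric_criteria.
Variables (R : realType) (X : metricType R) (f : X -> X).
Import metricType_numDomainType.

Lemma continuous_mdist :
  (forall p (e : R), 0 < e -> exists2 d : R, 0 < d &
     forall y, mdist p y < d -> mdist (f p) (f y) < e) -> continuous f.
Proof.
move=> fc p; apply/cvgrPdist_lt => e e0; have [d d0 pd] := fc p e e0.
by apply/nbhs_mdistP; exists d.
Qed.

Lemma omega_limitP x p : omega_limit f x p <->
  forall (e : R) N, 0 < e -> exists2 n, (N <= n)%N & mdist p (iter n f x) < e.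
Proof.
split=> [px e N e0|px A B [N _ NA] /nbhs_mdistP[e /= e0 eB]].
- have nA : (iter n f x @[n --> \oo])
      [set iter n f x | n in [set n | (N <= n)%N]].
    by exists N => // n Nn; exists n.
  have nB : nbhs p [set y | mdist p y < e] by apply/nbhs_mdistP; exists e.
  by have [_ [[n Nn <-]]] := px _ _ nA nB; exists n.
- have [n Nn ne] := px e N e0; exists (iter n f x); split; first exact: NA.
  exact: eB.
Qed.

End metric_criteria.

(** * Spiked metrics *)

(** The points are spikes over a pseudo-metric space: [label] and [pos] give the
    foot of a spike and [height] its length.  Several spikes may share a foot;
    only the points of height 0 must be determined by theirs. *)
Record spiked (R : realType) := Spiked {
  point : choiceType;
  color : choiceType;
  label : point -> color;
  pos : point -> R;
  height : point -> R;
  height_ge0 : forall a, 0 <= height a;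
  base_inj : forall a b, height a = 0 -> height b = 0 ->
    label a = label b -> pos a = pos b -> a = b
}.
Arguments label {R s}.
Arguments pos {R s}.
Arguments height {R s}.

Definition spike_space (R : realType) (s : spiked R) : Type := point s.

Section spike_metric.
Variables (R : realType) (s : spiked R).
Implicit Types a b c : point s.

HB.instance Definition _ := Choice.on (spike_space s).

(** Distance between feet; different labels are at distance at least 1. *)
Definition base_dist a b : R :=
  (label a != label b)%:R + `|pos a - pos b|.

(** A path from one spike to another descends the first and climbs the
    second. *)
Definition spike_dist a b : R :=
  if a == b then 0 else base_dist a b + height a + height b.

Lemma base_dist_ge0 a b : 0 <= base_dist a b.
Proof. by rewrite addr_ge0. Qed.

Lemma base_dist_triangle b a c : base_dist a c <= base_dist a b + base_dist b c.
Proof.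
rewrite addrACA lerD ?ler_distD// -natrD ler_nat.
have [->|_] := eqVneq (label a) (label b); first by rewrite add0n.
by rewrite (leq_trans (leq_b1 _))// leq_addr.
Qed.

Lemma base_dist_sym a b : base_dist a b = base_dist b a.
Proof. by rewrite /base_dist eq_sym distrC. Qed.

Lemma spike_distxx a : spike_dist a a = 0.
Proof. by rewrite /spike_dist eqxx. Qed.

Lemma spike_dist_sym a b : spike_dist a b = spike_dist b a.
Proof. by rewrite /spike_dist eq_sym base_dist_sym addrAC. Qed.

Lemma spike_dist_eq0 a b : spike_dist a b = 0 -> a = b.
Proof.
rewrite /spike_dist; case: eqVneq => // _ /eqP.
rewrite !paddr_eq0 ?addr_ge0 ?base_dist_ge0 ?height_ge0//.
move=> /andP[/andP[/andP[]]]; rewrite pnatr_eq0 eqb0 negbK normr_eq0 subr_eq0.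
by move=> /eqP la /eqP pa /eqP ha /eqP hb; exact: base_inj.
Qed.

Lemma spike_dist_triangle b a c :
  spike_dist a c <= spike_dist a b + spike_dist b c.
Proof.
have [<-|ab] := eqVneq a b; first by rewrite spike_distxx add0r.
have [<-|bc] := eqVneq b c; first by rewrite spike_distxx addr0.
rewrite /spike_dist (negPf ab) (negPf bc).
have := base_dist_triangle b a c; have := base_dist_ge0 a b.
have := base_dist_ge0 b c.
have := @height_ge0 _ s a; have := @height_ge0 _ s b; have := @height_ge0 _ s c.
by case: ifP => _; lra.
Qed.

HB.instance Definition _ := isMetric.Build R (spike_space s)
  spike_distxx spike_dist_eq0 spike_dist_sym spike_dist_triangle.

End spike_metric.

Section spike_metric_theory.
Variables (R : realType) (s : spiked R).
Implicit Types a b : spike_space s.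

Lemma mdist_spike a b : a != b ->
  mdist a b = base_dist a b + height a + height b.
Proof. by rewrite /mdist/= /spike_dist => /negPf ->. Qed.

Lemma mdist_label a b : label a != label b -> 1 <= mdist a b.
Proof.
move=> lab; have ab : a != b by apply: contra_neq lab => ->.
rewrite mdist_spike// /base_dist lab -!addrA lerDl.
by rewrite !addr_ge0// height_ge0.
Qed.

(** Points of positive height are isolated. *)
Lemma mdist_height a b : mdist a b < height a -> a = b.
Proof.
move=> dab; apply/eqP; apply: contraTT dab => ab; rewrite mdist_spike// -leNgt.
by rewrite addrAC lerDr addr_ge0 ?base_dist_ge0 ?height_ge0.
Qed.

End spike_metric_theory.

(** * A distributionally chaotic map without omega-limit points *)

(** The index k of the block [2^(2^k), 2^(2^(k+1))) that contains
    n >= 2. *)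
Definition log_log n := trunc_log 2 (trunc_log 2 n).

Definition block_start k := (2 ^ (2 ^ k))%N.

Lemma log_log_block k i :
  (block_start k <= i)%N -> (i < block_start k * block_start k)%N ->
  log_log i = k.
Proof.
rewrite /block_start -expnD addnn -mul2n -expnS => ki ik.
have i0 : (0 < i)%N by rewrite (leq_trans _ ki)// expn_gt0.
apply: trunc_log_eq => //; apply/andP; split; first exact: trunc_log_max.
have /andP[li _] := trunc_log_bounds (isT : (1 < 2)%N) i0.
by have := leq_ltn_trans li ik; rewrite ltn_exp2l.
Qed.

Lemma block_start_ge k : (k < block_start k)%N.
Proof.
exact: leq_ltn_trans (ltnW (ltn_expl k (ltnSn 1))) (ltn_expl _ (ltnSn 1)).
Qed.

(** The part of [0, B^2) below the block [B, B^2) has proportion 1/B, which is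
    arbitrarily small for blocks of either parity. *)
Lemma far_block (R : realType) (odd_k : bool) (e : R) N : 0 < e ->
  exists k, [/\ odd k = odd_k, (N <= block_start k)%N &
    (block_start k)%:R / (block_start k * block_start k)%:R <= e].
Proof.
move=> e0; pose M := (N + Num.bound e^-1)%N; pose k := (odd_k + M.*2)%N.
have MB : (M <= block_start k)%N.
  rewrite ltnW// (leq_ltn_trans _ (block_start_ge k))// /k -addnn addnCA.
  exact: leq_addr.
have B0 : (0 < block_start k)%N by exact: leq_ltn_trans (block_start_ge k).
exists k; split.
- by rewrite oddD odd_double addbF oddb.
- exact: leq_trans (leq_addr _ _) MB.
- rewrite natrM invfM mulrA mulfV ?pnatr_eq0 -?lt0n// mul1r.
  rewrite invf_ple ?posrE ?ltr0n// ltW//.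
  rewrite (lt_le_trans (archi_boundP _))// ?invr_ge0 ?(ltW e0)// ler_nat.
  exact: leq_trans (leq_addl _ _) MB.
Qed.

Section escaping.
Variable R : realType.

(** The predecessor makes index i of a frequency, sampled at time i + 1, fall
    into the block of i. *)
Definition level_height n : R := if odd (log_log n.-1) then 1 else n.+1%:R^-1.

Lemma level_height_gt0 n : 0 < level_height n.
Proof. by rewrite /level_height; case: ifP. Qed.

Lemma escaping_base_inj (a b : R * nat) :
  level_height a.2 = 0 -> level_height b.2 = 0 ->
  a.2 = b.2 -> 0 = 0 :> R -> a = b.
Proof. by move=> ha; have := level_height_gt0 a.2; rewrite ha ltxx. Qed.

Definition escaping_data : spiked R :=
  @Spiked R (R * nat)%type nat snd (fun=> 0) (fun a => level_height a.2)
    (fun a => ltW (level_height_gt0 a.2)) escaping_base_inj.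

Definition escaping := spike_space escaping_data.

Definition climb (a : escaping) : escaping := (a.1, a.2.+1).

Lemma iter_climb n a : iter n climb a = (a.1, (a.2 + n)%N).
Proof. by elim: n => [|n /= ->]; [rewrite addn0; case: a | rewrite addnS]. Qed.

Lemma mdist_escaping (x y : R) n : x <> y ->
  mdist ((x, n) : escaping) (y, n) = level_height n *+ 2.
Proof.
move=> xy; rewrite mdist_spike; last by apply/eqP => -[].
by rewrite /base_dist /= eqxx subrr normr0 addr0 add0r.
Qed.

Lemma climb_continuous : continuous climb.
Proof.
apply: continuous_mdist => p e e0; exists (level_height p.2).
  exact: level_height_gt0.
by move=> y /mdist_height <-; rewrite mdistxx.
Qed.

Lemma climb_omega a : omega_limit climb a = set0.
Proof.
apply/seteqP; split=> // p /omega_limitP op.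
have [n pn /mdist_height] := op _ p.2.+1 (level_height_gt0 p.2).
by rewrite iter_climb => pE; move: pn; rewrite pE/= ltnNge leq_addl.
Qed.

Lemma climb_not_omega_chaotic : ~ omega_chaotic climb.
Proof.
move=> [S [/uncountable_two[x [y [Sx Sy xy]]] scrambled]].
have [_ + _] := scrambled x y Sx Sy xy.
by rewrite climb_omega set0I => /set0P/eqP.
Qed.

Lemma climb_lower (x y : R) : x <> y ->
  lower_dist climb ((x, 0%N) : escaping) (y, 0%N) 1 succn = 0.
Proof.
move=> xy; apply: limn_inf_eq0; first exact: prox_freq_ge0.
move=> e e0 N; have [k [k_odd Nk ke]] := far_block true N e0.
exists (block_start k * block_start k)%N.
  by rewrite (leq_trans Nk)// leq_pmulr// (leq_ltn_trans _ (block_start_ge k)).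
apply: le_trans (prox_freq_le (N := block_start k) _) ke => i iB.
rewrite !iter_climb/= mdist_escaping// ltnNge => close_i.
apply/negP => Bi; move: close_i; rewrite /level_height/= (log_log_block Bi iB).
by rewrite k_odd mulr2n gtrDl ltr10.
Qed.

Lemma climb_upper (x y t : R) : 0 < t -> x <> y ->
  upper_dist climb ((x, 0%N) : escaping) (y, 0%N) t succn = 1.
Proof.
move=> t0 xy; apply: limn_sup_eq1; first exact: prox_freq_le1.
move=> e e0 N.
(* Beyond level 2 / t, the low levels bring points closer than t. *)
have [k [k_even Nk ke]] := far_block false (N + Num.bound (2 / t)) e0.
have B0 : (0 < block_start k)%N by exact: leq_ltn_trans (block_start_ge k).
exists (block_start k * block_start k)%N.
  by rewrite (leq_trans (leq_addr _ _) (leq_trans Nk _))// leq_pmulr.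
apply: le_trans (prox_freq_ge (N := block_start k) _ _).
- by rewrite lerD2l lerN2.
- by rewrite muln_gt0 B0.
- move=> i iB; rewrite !iter_climb/= mdist_escaping// ltnNge => far_i.
  apply/negP => Bi; move: far_i; rewrite /level_height/= (log_log_block Bi iB).
  rewrite k_even -[X in X < t]mulr_natl => /negP; apply.
  rewrite ltr_pdivrMr ?ltr0n// mulrC -ltr_pdivrMr//.
  rewrite (lt_le_trans (archi_boundP _))// ?divr_ge0 ?(ltW t0)// ler_nat.
  by rewrite !leqW// (leq_trans (leq_addl _ _) (leq_trans Nk Bi)).
Qed.

Lemma climb_SDC : SDC climb.
Proof.
exists succn; split=> //.
exists [set a : escaping | a.2 = 0%N]; split.
  move=> cS; apply: (@uncountable_realType R).
  apply: (@countable_image_inj _ escaping _ (fun x => (x, 0%N))).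
    by move=> x y _ _ [].
  apply: sub_countable cS; apply: subset_card_le.
  by move=> _ [x _ <-].
move=> [x _] [y _] /= -> -> xy.
have {}xy : x <> y by move=> E; apply: xy; rewrite E.
split; last by move=> t t0; exact: climb_upper.
by exists 1 => //; exact: climb_lower.
Qed.

End escaping.

(** * The times of a wanderer *)

Section phases.

(** (m, j) stands for step j of block m.  The steps j > m are not reached from
    the start of a block; they are also followed by the next block. *)
Definition phase := (nat * nat)%type.

Definition next_phase (p : phase) : phase :=
  if (p.2 < p.1)%N then (p.1, p.2.+1) else (p.1.+1, 0%N).

Lemma iter_next_phase m n :
  (n <= m)%N -> iter n next_phase (m, 0%N) = (m, n).
Proof. by elim: n => // n IH nm /=; rewrite IH 1?ltnW// /next_phase/= nm. Qed.

Lemma block_reached m :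
  exists2 n, (m <= n)%N & iter n next_phase (0, 0)%N = (m, 0%N).
Proof.
elim: m => [|m [n mn nE]]; first by exists 0%N.
exists (m.+1 + n)%N; first by rewrite (leq_trans _ (leq_addr _ _)).
by rewrite iterD nE iterS iter_next_phase// /next_phase /= ltnn.
Qed.

Lemma next_phase_fst p : (p.1 <= (next_phase p).1)%N.
Proof. by rewrite /next_phase; case: ifP => _ /=. Qed.

Lemma block_increases p : exists n, (p.1 < (iter n next_phase p).1)%N.
Proof.
case: p => m j /=.
have [d] := ubnP (m - j)%N; elim: d j => // d IH j.
have [jm|mj] := ltnP j m; last first.
  by exists 1%N; rewrite /= /next_phase /= (leq_gtF mj).
rewrite ltnS => jd; have [|n mn] := IH j.+1.
  by rewrite subnS (leq_trans _ jd)// prednK// subn_gt0.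
by exists n.+1; rewrite iterSr /next_phase /= jm.
Qed.

Lemma block_unbounded p M :
  exists N, forall n, (N <= n)%N -> (M <= (iter n next_phase p).1)%N.
Proof.
suff [N NM] : exists N, (M <= (iter N next_phase p).1)%N.
  exists N => n /subnK <-; elim: (n - N)%N => // k IH.
  by rewrite addSn iterS (leq_trans IH)// next_phase_fst.
elim: M => [|M [N MN]]; first by exists 0%N.
have [n lt_n] := block_increases (iter N next_phase p).
by exists (n + N)%N; rewrite iterD (leq_ltn_trans MN).
Qed.

End phases.

(** * An omega-chaotic map with separated pairs *)

Section visiting.
Variable R : realType.

(** Blocks are numbered by tasks: (k, z) invites the wanderers s with
    floor (k s) = z to the common fibre, and (q, i) is the i-th request to go
    near q in the private fibre. *)
Definition code : countType := ((nat * int) + (rat * nat))%type.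

Definition target (s : R) (m : nat) : option R * R :=
  match @pickle_inv code m with
  | Some (inl (k, z)) => (if Num.floor (s * k%:R) == z then None else Some s, 0)
  | Some (inr (q, _)) => (Some s, ratr q)
  | None => (Some s, 0)
  end.

Lemma target_or s m : (target s m).1 = None \/ (target s m).1 = Some s.
Proof.
rewrite /target; case: pickle_inv => [[[k z]|[q k]]|] /=; [|by right..].
by case: ifP; [left | right].
Qed.

Lemma target_meet s m : (target s m).1 = None ->
  exists k, m = @pickle code (inl (k, Num.floor (s * k%:R))).
Proof.
rewrite /target; case: pickle_inv (@pickle_invK code m) => [[[k z]|[q k]]|] //=.
by move=> <-; case: ifP => // /eqP <- _; exists k.
Qed.

Lemma floor_dist_lt1 (a b : R) : Num.floor a = Num.floor b -> `|a - b| < 1.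
Proof.
move=> ab; have := floor_itv a; have := floor_itv b; rewrite ab.
rewrite intrD => /andP[? ?] /andP[? ?]; rewrite ltr_norml; apply/andP; lra.
Qed.

(** For k >= 1 / |s - s'| the reals k s and k s' have different floors, so no
    task (k, z) invites both; for each smaller k there is only one task that
    invites s. *)
Lemma target_almost_disjoint s s' : s != s' ->
  exists M, forall m, (M <= m)%N -> (target s m).1 != (target s' m).1.
Proof.
move=> ss'; have d0 : 0 < `|s - s'| by rewrite normr_gt0 subr_eq0.
pose K := Num.bound (`|s - s'|^-1).
exists (\max_(k < K) @pickle code (inl (k : nat, Num.floor (s * k%:R)))).+1.
move=> m; rewrite leqNgt; apply: contra => /eqP meet; rewrite ltnS.
have sN : (target s m).1 = None.
  have [//|sE] := target_or s m.
  have [|s'E] := target_or s' m; first by rewrite -meet.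
  by move: meet ss'; rewrite sE s'E => -[->]; rewrite eqxx.
have [k mE] := target_meet sN.
have [k' mE'] := target_meet (etrans (esym meet) sN).
have := pcan_inj (@pickleK code) (etrans (esym mE) mE').
move=> -[<- /floor_dist_lt1].
rewrite -mulrBl normrM normr_nat mulrC => kd.
have kK : (k < K)%N.
  rewrite -(ltr_nat R) (lt_trans _ (archi_boundP _)) ?invr_ge0//.
  by rewrite -[ltRHS]mul1r ltr_pdivlMr.
rewrite mE.
exact: (@leq_bigmax _ (fun k : 'I_K =>
  @pickle code (inl (k : nat, Num.floor (s * k%:R)))) (Ordinal kK)).
Qed.

(** Limit points (fibre, position, step), and wanderers with their phase. *)
Definition visit_point : Type := ((option R * R * nat) + (R * phase))%type.

Definition visit_label (a : visit_point) : option R * nat :=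
  match a with
  | inl (c, x, k) => (c, k)
  | inr (s, (m, j)) => ((target s m).1, j)
  end.

Definition visit_pos (a : visit_point) : R :=
  match a with inl (c, x, k) => x | inr (s, (m, j)) => (target s m).2 end.

Definition visit_height (a : visit_point) : R :=
  match a with inl _ => 0 | inr (s, (m, j)) => m.+1%:R^-1 end.

Lemma visit_height_ge0 a : 0 <= visit_height a.
Proof. by case: a => [//|[s [m j]]] /=. Qed.

Lemma visit_base_inj a b : visit_height a = 0 -> visit_height b = 0 ->
  visit_label a = visit_label b -> visit_pos a = visit_pos b -> a = b.
Proof.
case: a => [[[c x] k] _|[s [m j]] /= /eqP]; last by rewrite invr_eq0 pnatr_eq0.
case: b => [[[c' x'] k'] _|[s [m j]] /= /eqP]; last first.
  by rewrite invr_eq0 pnatr_eq0.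
by move=> [-> ->] /= ->.
Qed.

Definition visiting_data : spiked R :=
  Spiked visit_height_ge0 visit_base_inj.

Definition visiting := spike_space visiting_data.

Definition visit (a : visiting) : visiting :=
  match a with
  | inl (c, x, k) => inl (c, x, k.+1)
  | inr (s, p) => inr (s, next_phase p)
  end.

Lemma iter_visit_limit n c x k :
  iter n visit (inl (c, x, k)) = inl (c, x, (k + n)%N).
Proof. by elim: n => [|n /= ->]; rewrite ?addn0 ?addnS. Qed.

Lemma iter_visit_wander n s p :
  iter n visit (inr (s, p)) = inr (s, iter n next_phase p).
Proof. by elim: n => [|n /= ->]. Qed.

Lemma visit_mdist_limit c x k c' x' k' :
  mdist (visit (inl (c, x, k))) (visit (inl (c', x', k'))) =
  mdist (inl (c, x, k) : visiting) (inl (c', x', k')).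
Proof.
have E : (inl (c, x, k.+1) == inl (c', x', k'.+1) :> visiting) =
         (inl (c, x, k) == inl (c', x', k') :> visiting).
  by apply/eqP/eqP => -[-> -> ->].
by rewrite /mdist /= /spike_dist E /base_dist /= !xpair_eqE eqSS.
Qed.

(** Near a limit point of step k the wanderers have the same step k, and are so
    low that their block is longer than k; hence they do not jump, and [visit]
    does not increase their distance to the limit point. *)
Lemma visit_continuous : continuous visit.
Proof.
apply: continuous_mdist => p e e0; case: p => [[[c x] k]|[s [m j]]]; last first.
  exists (m.+1%:R^-1) => // y; move/(@mdist_height _ visiting_data) => <-.
  by rewrite mdistxx.
exists (Num.min e (k.+1%:R^-1)); first by rewrite lt_min e0/=.
move=> y; rewrite lt_min => /andP[de dk].
case: y de dk => [[[c' x'] k']|[s [m j]]] de dk.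
  by rewrite visit_mdist_limit.
have lab : label (inl (c, x, k) : visiting) =
           label (inr (s, (m, j)) : visiting).
  apply/eqP; rewrite -[_ == _]negbK; apply/negP => /mdist_label.
  by rewrite leNgt (lt_le_trans dk)// invf_le1 ?ler1n.
have km : (k < m)%N.
  rewrite -ltnS -(ltr_nat R) -ltf_pV2 ?posrE//; apply: le_lt_trans dk.
  by rewrite mdist_spike// lerDr addr0 base_dist_ge0.
move: lab => -[cE jE]; rewrite -jE in de *; apply: le_lt_trans de.
by rewrite /visit /next_phase /= km !mdist_spike// /base_dist /= cE !eqxx.
Qed.

Definition start (s : R) : visiting := inr (s, (0, 0)%N).

(** At the start of block m the wanderer is within 1 / (m + 1) of its target,
    and the time is at least m. *)
Lemma omega_of_targets s c x :
  (forall (e : R) N, 0 < e -> exists m,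
     [/\ (N <= m)%N, (target s m).1 = c & `|x - (target s m).2| < e]) ->
  omega_limit visit (start s) (inl (c, x, 0%N)).
Proof.
move=> near_x; apply/omega_limitP => e N e0.
have e2 : 0 < e / 2 by rewrite divr_gt0.
have [m [Nm mc mx]] := near_x _ (N + Num.bound (e / 2)^-1)%N e2.
have [n mn nE] := block_reached m.
exists n; first by rewrite (leq_trans _ mn)// (leq_trans _ Nm)// leq_addr.
rewrite iter_visit_wander nE mdist_spike// /base_dist /= mc eqxx add0r addr0.
rewrite [ltRHS](splitr e) ltrD// invf_plt ?posrE//.
rewrite (lt_le_trans (archi_boundP _))// ?invr_ge0 ?(ltW e2)// ler_nat.
by rewrite leqW// (leq_trans _ Nm)// leq_addl.
Qed.

Lemma omega_start_own s x : omega_limit visit (start s) (inl (Some s, x, 0%N)).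
Proof.
apply: omega_of_targets => e N e0.
have /rat_in_itvoo[q] : x - e < x + e by lra.
rewrite in_itv/= => /andP[q1 q2].
have [|k Nk] := @injective_nat_unbounded
  (fun k => @pickle code (inr (q, k))) _ N.
  by move=> k k' /(pcan_inj pickleK)[].
exists (@pickle code (inr (q, k))); split=> //; rewrite /target pickleK_inv//=.
by rewrite ltr_norml; apply/andP; lra.
Qed.

Lemma omega_start_common s : omega_limit visit (start s) (inl (None, 0, 0%N)).
Proof.
apply: omega_of_targets => e N e0.
have [|k Nk] := @injective_nat_unbounded
  (fun k => @pickle code (inl (k, Num.floor (s * k%:R)))) _ N.
  by move=> k k' /(pcan_inj pickleK)[].
exists (@pickle code (inl (k, Num.floor (s * k%:R)))).
by rewrite /target pickleK_inv eqxx/= subrr normr0.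
Qed.

Lemma omega_start_other s s' x : s <> s' ->
  ~ omega_limit visit (start s) (inl (Some s', x, 0%N)).
Proof.
move=> ss' /omega_limitP/(_ 1 0%N ltr01)[n _]; apply/negP; rewrite -leNgt.
apply: mdist_label; rewrite iter_visit_wander.
case: (iter n next_phase _) => m j /=; apply/eqP => -[sE _].
by case: (target_or s m); rewrite -sE// => -[] /esym.
Qed.

Lemma visit_omega_chaotic : omega_chaotic visit.
Proof.
exists (range start); split.
  move=> cS; apply: (@uncountable_realType R).
  by apply: countable_image_inj cS => x y _ _ [].
move=> _ _ [s _ <-] [s' _ <-] ss'.
have {}ss' : s' <> s by move=> E; apply: ss'; rewrite E.
split.
- move=> cD; apply: (@uncountable_realType R).
  apply: (@countable_image_inj _ visiting _ (fun x => inl (Some s, x, 0%N))).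
    by move=> x y _ _ [].
  apply: sub_countable cD; apply: subset_card_le => _ [x _ <-]; split.
    exact: omega_start_own.
  exact: omega_start_other.
- by exists (inl (None, 0, 0%N)); split; exact: omega_start_common.
- move=> /(_ _ (@omega_start_own s 0))[n n0].
  by rewrite iter_visit_limit => -[]; rewrite add0n => nE; rewrite nE in n0.
Qed.

Lemma wander_apart p s s' : s != s' -> exists N, forall n, (N <= n)%N ->
  1 <= mdist (iter n visit (inr (s, p))) (iter n visit (inr (s', p))).
Proof.
move=> /target_almost_disjoint[M Mm]; have [N NM] := block_unbounded p M.
exists N => n /NM; rewrite !iter_visit_wander.
case: (iter n next_phase p) => m j /= /Mm tm.
by apply: mdist_label => /=; rewrite xpair_eqE negb_and tm.
Qed.

(** Coarse enough to take countably many values, fine enough to keep distinct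
    points with the same value from becoming proximal. *)
Definition visit_class (a : visiting) : option phase :=
  if a is inr (_, p) then Some p else None.

Lemma same_class_apart a b : a <> b -> visit_class a = visit_class b ->
  exists (t : R) N, 0 < t /\
    forall n, (N <= n)%N -> t <= mdist (iter n visit a) (iter n visit b).
Proof.
case: a b => [[[c x] k]|[s p]] [[[c' x'] k']|[s' p']]//= ab.
  move=> _; exists (mdist (inl (c, x, k) : visiting) (inl (c', x', k'))), 0%N.
  split; first by rewrite mdist_gt0; exact/eqP.
  move=> n _; elim: n => // n /le_trans; apply.
  by rewrite !iterS !iter_visit_limit visit_mdist_limit.
move=> [pE]; rewrite -{p'}pE in ab *; exists 1.
have /(wander_apart p)[N NP] : s != s' by apply/eqP => E; apply: ab; rewrite E.
by exists N.
Qed.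

Lemma visit_not_SDC : ~ SDC visit.
Proof.
move=> [q [incq _ [S [ncS SDC_S]]]].
suff : {in S &, injective visit_class}.
  by move/countable_image_inj => cS; exact/ncS/cS/countableP.
move=> a b /set_mem Sa /set_mem Sb cab; apply: contrapT => ab.
have [t [N [t0 apart]]] := same_class_apart ab cab.
have [_ /(_ t t0)] := SDC_S a b Sa Sb ab.
by rewrite (upper_dist_apart incq apart) => /esym/eqP; rewrite oner_eq0.
Qed.

End visiting.

(** * The two examples *)

Theorem theorem3 (R : realType) :
  (exists (X : metricType R) (f : X -> X),
     [/\ continuous f, SDC f & ~ omega_chaotic f]) /\
  (exists (Y : metricType R) (g : Y -> Y),
     [/\ continuous g, omega_chaotic g & ~ SDC g]).
Proof.
split.
- exists (escaping R), (@climb R); split.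
  + exact: climb_continuous.
  + exact: climb_SDC.
  + exact: climb_not_omega_chaotic.
- exists (visiting R), (@visit R); split.
  + exact: visit_continuous.
  + exact: visit_omega_chaotic.
  + exact: visit_not_SDC.
Qed.
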